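(* Let $H$ carry a pre-Hopf-Frobenius algebra structure in a strict symmetric monoidal category $\mathcal{C}$, with green monoid $(\mu_g,\eta_g)$, green comonoid $(\delta_g,\varepsilon_g)$, red monoid $(\mu_r,\eta_r)$, red comonoid $(\delta_r,\varepsilon_r)$ and antipode $s$. Then $(H,\eta_r,\varepsilon_g)$ is an integral Hopf algebra (for the Hopf algebra $(H,\mu_g,\eta_g,\delta_r,\varepsilon_r,s)$) if and only if $$s=\big(\mathrm{id}_H\otimes(\varepsilon_r\circ\mu_r)\big)\circ\big((\delta_g\circ\eta_g)\otimes\mathrm{id}_H\big).$$
   Context: $\mathcal{C}$ is a strict symmetric monoidal category with unit object $I$ and symmetry $\sigma$. A Hopf algebra $(H,\mu,\eta,\Delta,\varepsilon,s)$: an object $H$ with an associative unital monoid $(\mu,\eta)$ and coassociative counital comonoid $(\Delta,\varepsilon)$ satisfying $\Delta\circ\mu=(\mu\otimes\mu)\circ(\mathrm{id}\otimes\sigma_{H,H}\otimes\mathrm{id})\circ(\Delta\otimes\Delta)$, $\Delta\circ\eta=\eta\otimes\eta$, $\varepsilon\circ\mu=\varepsilon\otimes\varepsilon$, $\varepsilon\circ\eta=\mathrm{id}_I$, and $s\colon H\to H$ with $\mu\circ(s\otimes\mathrm{id})\circ\Delta=\eta\circ\varepsilon=\mu\circ(\mathrm{id}\otimes s)\circ\Delta$. For such a Hopf algebra, a left cointegral is a point $\Lambda\colon I\to H$ with $\mu\circ(\Lambda\otimes\mathrm{id}_H)=\Lambda\circ\varepsilon$; a right integral is a copoint $\lambda\colon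 H\to I$ with $(\mathrm{id}_H\otimes\lambda)\circ\Delta=\eta\circ\lambda$; $(H,\Lambda,\lambda)$ is an integral Hopf algebra if $\Lambda$ is a left cointegral, $\lambda$ a right integral and $\lambda\circ\Lambda=\mathrm{id}_I$. A Frobenius algebra is a monoid $(m,u)$ and comonoid $(d,c)$ on the same object with $(\mathrm{id}\otimes m)\circ(d\otimes\mathrm{id})=d\circ m=(m\otimes\mathrm{id})\circ(\mathrm{id}\otimes d)$. A pre-Hopf-Frobenius algebra consists of an object $H$ with a green monoid $(\mu_g,\eta_g)$, green comonoid $(\delta_g,\varepsilon_g)$, red monoid $(\mu_r,\eta_r)$, red comonoid $(\delta_r,\varepsilon_r)$ and an endomorphism $s$ such that $(\mu_g,\eta_g,\delta_g,\varepsilon_g)$ and $(\mu_r,\eta_r,\delta_r,\varepsilon_r)$ are Frobenius algebras and $(\mu_g,\eta_g,\delta_r,\varepsilon_r,s)$ is a Hopf algebra. *)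

(* Defs.v *)
(* no category-theory library is installed, so we define
   strict symmetric monoidal categories ourselves, in the one-sorted
   (arrows-only style) presentation: a type of objects, a type of morphisms
   with domain/codomain maps, and total composition/tensor operations whose
   laws are required whenever the arguments are composable.  This avoids
   dependent-type transports when expressing strictness
   ((a ⊗ b) ⊗ c = a ⊗ (b ⊗ c), I ⊗ a = a = a ⊗ I). *)

Record SSMC : Type := {
  Ob : Type;
  Mor : Type;
  dom : Mor -> Ob;
  cod : Mor -> Ob;
  idm : Ob -> Mor;
  comp : Mor -> Mor -> Mor;
  tens0 : Ob -> Ob -> Ob;
  tens1 : Mor -> Mor -> Mor;
  unitOb : Ob;
  sym : Ob -> Ob -> Mor;
  dom_idm : forall a, dom (idm a) = a;
  cod_idm : forall a, cod (idm a) = a;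
  dom_comp : forall g f, cod f = dom g -> dom (comp g f) = dom f;
  cod_comp : forall g f, cod f = dom g -> cod (comp g f) = cod g;
  comp_idl : forall f, comp (idm (cod f)) f = f;
  comp_idr : forall f, comp f (idm (dom f)) = f;
  comp_assoc : forall h g f, cod f = dom g -> cod g = dom h ->
      comp h (comp g f) = comp (comp h g) f;
  dom_tens : forall f g, dom (tens1 f g) = tens0 (dom f) (dom g);
  cod_tens : forall f g, cod (tens1 f g) = tens0 (cod f) (cod g);
  tens_idm : forall a b, tens1 (idm a) (idm b) = idm (tens0 a b);
  tens_comp : forall g f g' f', cod f = dom g -> cod f' = dom g' ->
      tens1 (comp g f) (comp g' f') = comp (tens1 g g') (tens1 f f');
  tens0_assoc : forall a b c, tens0 (tens0 a b) c = tens0 a (tens0 b c);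
  tens0_unitl : forall a, tens0 unitOb a = a;
  tens0_unitr : forall a, tens0 a unitOb = a;
  tens1_assoc : forall f g h, tens1 (tens1 f g) h = tens1 f (tens1 g h);
  tens1_unitl : forall f, tens1 (idm unitOb) f = f;
  tens1_unitr : forall f, tens1 f (idm unitOb) = f;
  dom_sym : forall a b, dom (sym a b) = tens0 a b;
  cod_sym : forall a b, cod (sym a b) = tens0 b a;
  sym_nat : forall f g,
      comp (sym (cod f) (cod g)) (tens1 f g) = comp (tens1 g f) (sym (dom f) (dom g));
  sym_invol : forall a b, comp (sym b a) (sym a b) = idm (tens0 a b);
  sym_hexagon : forall a b c,
      sym a (tens0 b c) = comp (tens1 (idm b) (sym a c)) (tens1 (sym a b) (idm c));
  sym_unit : forall a, sym a unitOb = idm a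
}.

Arguments dom {s} _. Arguments cod {s} _. Arguments idm {s} _.
Arguments comp {s} _ _. Arguments tens0 {s} _ _. Arguments tens1 {s} _ _.
Arguments unitOb {s}. Arguments sym {s} _ _.

Declare Scope ssmc_scope.
Open Scope ssmc_scope.
Notation "g ∘ f" := (comp g f) (at level 40, left associativity) : ssmc_scope.
Notation "f ⊗ g" := (tens1 f g) (at level 35, right associativity) : ssmc_scope.
Notation "a ⊗o b" := (tens0 a b) (at level 35, right associativity) : ssmc_scope.

Section Algebra.
Variable C : SSMC.
Variable H : Ob C.

Definition hom (f : Mor C) (a b : Ob C) : Prop := dom f = a /\ cod f = b.

Definition id_H : Mor C := idm H.

Definition is_monoid (m u : Mor C) : Prop :=
  hom m (H ⊗o H) H /\ hom u unitOb H /\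
  m ∘ (m ⊗ id_H) = m ∘ (id_H ⊗ m) /\
  m ∘ (u ⊗ id_H) = id_H /\ m ∘ (id_H ⊗ u) = id_H.

Definition is_comonoid (d c : Mor C) : Prop :=
  hom d H (H ⊗o H) /\ hom c H unitOb /\
  (d ⊗ id_H) ∘ d = (id_H ⊗ d) ∘ d /\
  (c ⊗ id_H) ∘ d = id_H /\ (id_H ⊗ c) ∘ d = id_H.

Definition is_frobenius (m u d c : Mor C) : Prop :=
  is_monoid m u /\ is_comonoid d c /\
  (id_H ⊗ m) ∘ (d ⊗ id_H) = d ∘ m /\
  d ∘ m = (m ⊗ id_H) ∘ (id_H ⊗ d).

Definition is_hopf (mu eta Delta eps s : Mor C) : Prop :=
  is_monoid mu eta /\ is_comonoid Delta eps /\ hom s H H /\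
  Delta ∘ mu = (mu ⊗ mu) ∘ (id_H ⊗ sym H H ⊗ id_H) ∘ (Delta ⊗ Delta) /\
  Delta ∘ eta = eta ⊗ eta /\
  eps ∘ mu = eps ⊗ eps /\
  eps ∘ eta = idm unitOb /\
  mu ∘ (s ⊗ id_H) ∘ Delta = eta ∘ eps /\
  eta ∘ eps = mu ∘ (id_H ⊗ s) ∘ Delta.

Definition is_left_cointegral (mu eps Lambda : Mor C) : Prop :=
  hom Lambda unitOb H /\ mu ∘ (Lambda ⊗ id_H) = Lambda ∘ eps.

Definition is_right_integral (eta Delta lambda : Mor C) : Prop :=
  hom lambda H unitOb /\ (id_H ⊗ lambda) ∘ Delta = eta ∘ lambda.

Definition is_integral_hopf (mu eta Delta eps s Lambda lambda : Mor C) : Prop :=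
  is_hopf mu eta Delta eps s /\
  is_left_cointegral mu eps Lambda /\
  is_right_integral eta Delta lambda /\
  lambda ∘ Lambda = idm unitOb.

Definition is_pre_hopf_frobenius
    (mug etag deltag epsg mur etar deltar epsr s : Mor C) : Prop :=
  is_frobenius mug etag deltag epsg /\
  is_frobenius mur etar deltar epsr /\
  is_hopf mug etag deltar epsr s.

End Algebra.

(* Main.v *)
(* The two Frobenius structures identify maps H -> H with copairings I -> H ⊗ H by
   transposing along the snake identities; the formula says that s is the red transpose of
   the green copairing δ_g η_g, i.e. (s ⊗ id) δ_r η_r = δ_g η_g.
   If η_r and ε_g are integrals with ε_g η_r = id, the Hopf identity S(Λ1) λ(Λ2 x) = x says
   that (s ⊗ id) δ_r η_r is a copairing inverse to the green pairing ε_g μ_g, and such a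
   copairing is unique.  Conversely, from (s ⊗ id) δ_r η_r = δ_g η_g and ε_r s = ε_r one
   reads off η_r = (ε_r ⊗ id) δ_g η_g, hence ε_g μ_g (η_r ⊗ id) = ε_r; nondegeneracy of
   the green pairing turns this into the cointegral property, and ε_g μ_g (id ⊗ s) = ε_r μ_r
   gives ε_g = ε_r μ_r (id ⊗ η_g), from which the red Frobenius law yields the right
   integral property. *)

Require Import Defs.
From Stdlib Require Import Setoid.

Section TensorPowers.
Variables (C : SSMC) (H : Ob C).
Implicit Types (f g h k : Mor C) (A : Ob C).

Fixpoint Hpow (n : nat) : Ob C :=
  match n with 0 => unitOb | S k => match k with 0 => H | _ => H ⊗o Hpow k end end.

Lemma Hpow_add a b : Hpow (a + b) = Hpow a ⊗o Hpow b.
Proof.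
  induction a as [|[|a] IH]; cbn [Nat.add].
  - now rewrite tens0_unitl.
  - now destruct b; [rewrite tens0_unitr|].
  - change (H ⊗o Hpow (S a + b) = (H ⊗o Hpow (S a)) ⊗o Hpow b).
    now rewrite IH, tens0_assoc.
Qed.

Definition homH f a b := hom C f (Hpow a) (Hpow b).

Lemma homH_comp f g a b b' c : homH f a b -> homH g b' c -> b = b' -> homH (g ∘ f) a c.
Proof.
  intros [df cf] [dg cg] <-; split.
  - rewrite dom_comp; congruence.
  - rewrite cod_comp; congruence.
Qed.

Lemma homH_tens f g a b a' b' n n' :
  homH f a b -> homH g a' b' -> n = a + a' -> n' = b + b' -> homH (f ⊗ g) n n'.
Proof.
  intros [df cf] [dg cg] -> ->; split.
  - now rewrite dom_tens, Hpow_add, df, dg.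
  - now rewrite cod_tens, Hpow_add, cf, cg.
Qed.

Lemma homH_idm n : homH (idm (Hpow n)) n n.
Proof. split; [apply dom_idm | apply cod_idm]. Qed.

Lemma homH_sym : homH (sym H H) 2 2.
Proof. split; [apply dom_sym | apply cod_sym]. Qed.

Lemma composable_homH f g a b b' c : homH f a b -> homH g b' c -> b = b' -> cod f = dom g.
Proof. intros [_ cf] [dg _] <-; congruence. Qed.

Lemma dom_homH f a b : homH f a b -> dom f = Hpow a. Proof. now intros []. Qed.
Lemma cod_homH f a b : homH f a b -> cod f = Hpow b. Proof. now intros []. Qed.

Lemma idm_comp f A : cod f = A -> idm A ∘ f = f.
Proof. intros <-; apply comp_idl. Qed.

Lemma comp_idm f A : dom f = A -> f ∘ idm A = f.
Proof. intros <-; apply comp_idr. Qed.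

Lemma tens_factorl f g : f ⊗ g = (f ⊗ idm (cod g)) ∘ (idm (dom f) ⊗ g).
Proof. rewrite <- tens_comp by now rewrite ?cod_idm, ?dom_idm. now rewrite comp_idr, comp_idl. Qed.

Lemma tens_factorr f g : f ⊗ g = (idm (cod f) ⊗ g) ∘ (f ⊗ idm (dom g)).
Proof. rewrite <- tens_comp by now rewrite ?cod_idm, ?dom_idm. now rewrite comp_idr, comp_idl. Qed.

Lemma tens_compl g f k : cod f = dom g -> (g ∘ f) ⊗ k = (g ⊗ k) ∘ (f ⊗ idm (dom k)).
Proof. intros. rewrite <- tens_comp by now rewrite ?cod_idm. now rewrite comp_idr. Qed.

Lemma tens_compr k g f : cod f = dom g -> k ⊗ (g ∘ f) = (k ⊗ g) ∘ (idm (dom k) ⊗ f).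
Proof. intros. rewrite <- tens_comp by now rewrite ?cod_idm. now rewrite comp_idr. Qed.

Lemma tens_comp_idml g f A : cod f = dom g -> (g ∘ f) ⊗ idm A = (g ⊗ idm A) ∘ (f ⊗ idm A).
Proof. intros. now rewrite tens_compl, dom_idm. Qed.

Lemma tens_comp_idmr g f A : cod f = dom g -> idm A ⊗ (g ∘ f) = (idm A ⊗ g) ∘ (idm A ⊗ f).
Proof. intros. now rewrite tens_compr, dom_idm. Qed.

Lemma tens_comp_chain g g' f f' k : cod f = dom g -> cod f' = dom g' -> cod k = dom (f ⊗ f') ->
  (g ⊗ g') ∘ ((f ⊗ f') ∘ k) = ((g ∘ f) ⊗ (g' ∘ f')) ∘ k.
Proof.
  intros. rewrite tens_comp by assumption.
  apply comp_assoc; [assumption | rewrite dom_tens, cod_tens; congruence].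
Qed.

Lemma comp_chain2 g f r k : g ∘ f = r -> cod k = dom f -> cod f = dom g -> g ∘ (f ∘ k) = r ∘ k.
Proof. intros <- ? ?. now apply comp_assoc. Qed.

Lemma comp_chain3 h g f r k : h ∘ (g ∘ f) = r -> cod k = dom f -> cod f = dom g -> cod g = dom h ->
  h ∘ (g ∘ (f ∘ k)) = r ∘ k.
Proof.
  intros <- ? ? ?. rewrite (comp_assoc _ g f k) by assumption.
  apply comp_assoc; [rewrite dom_comp | rewrite cod_comp]; auto.
Qed.

Lemma sym_unitl A : sym unitOb A = idm A.
Proof.
  pose proof (sym_invol C A unitOb) as inv.
  rewrite sym_unit, tens0_unitr in inv. rewrite <- inv.
  symmetry; apply comp_idm. now rewrite dom_sym, tens0_unitl.
Qed.

Lemma sym_point p A B : hom C p unitOb B -> sym B A ∘ (p ⊗ idm A) = idm A ⊗ p.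
Proof.
  intros [dp <-]. pose proof (sym_nat C p (idm A)) as nat.
  rewrite cod_idm, dom_idm, dp, sym_unitl in nat. rewrite nat.
  apply comp_idm. now rewrite dom_tens, dom_idm, dp, tens0_unitr.
Qed.

End TensorPowers.

Arguments Hpow {C}.
Arguments homH {C}.

(* All morphisms below are composites of maps H^a -> H^b, so the side conditions
   [cod f = dom g] of the one-sorted category are decided by computing arities. *)
Ltac solve_homH := match goal with
 | |- homH _ (?g ∘ ?f) _ _ => eapply homH_comp; [solve_homH | solve_homH | reflexivity]
 | |- homH _ (?f ⊗ ?g) _ _ => eapply homH_tens; [solve_homH | solve_homH | reflexivity | reflexivity]
 | |- homH ?H (idm ?H) _ _ => exact (homH_idm _ H 1)
 | |- homH ?H (sym ?H ?H) _ _ => apply homH_sym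
 | |- homH _ _ _ _ => eassumption
end.

Ltac solve_obj_eq := cbn [Hpow Nat.add];
  repeat rewrite ?tens0_unitl, ?tens0_unitr, ?tens0_assoc; reflexivity.

Ltac base_object := lazymatch goal with _ : homH ?H _ _ _ |- _ => H end.

Ltac solve_composable := let H := base_object in match goal with
 | |- cod ?f = dom ?g => eapply (composable_homH _ H); [solve_homH | solve_homH | reflexivity]
 | |- dom ?g = cod ?f => symmetry; eapply (composable_homH _ H); [solve_homH | solve_homH | reflexivity]
 | |- cod ?f = _ =>
     let h := fresh in eassert (h : homH H f _ _) by solve_homH;
     rewrite (cod_homH _ _ _ _ _ h); clear h; solve_obj_eq
 | |- dom ?f = _ =>
     let h := fresh in eassert (h : homH H f _ _) by solve_homH;
     rewrite (dom_homH _ _ _ _ _ h); clear h; solve_obj_eq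
end.

Ltac assoc_r := repeat (rewrite <- comp_assoc by solve_composable).

(* Rewrites with [E : g ∘ f = r] or [E : h ∘ (g ∘ f) = r] at the head of a right-nested
   composite [g ∘ (f ∘ k)] or [h ∘ (g ∘ (f ∘ k))]. *)
Ltac rewrite_chain E := assoc_r;
  first [ rewrite (comp_chain3 _ _ _ _ _ _ E) by solve_composable
        | rewrite (comp_chain2 _ _ _ _ _ E) by solve_composable
        | rewrite E ]; assoc_r.

Ltac merge_tens := match goal with
 | |- context [(?g ⊗ ?g') ∘ ((?f ⊗ ?f') ∘ ?k)] =>
     rewrite (tens_comp_chain _ g g' f f' k) by solve_composable
 | |- context [(?g ⊗ ?g') ∘ (?f ⊗ ?f')] =>
     rewrite <- (tens_comp _ g f g' f') by solve_composable
end.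

Ltac simpl_idm :=
  repeat first [ rewrite tens_idm | rewrite idm_comp by solve_composable
               | rewrite comp_idm by solve_composable ];
  repeat rewrite <- tens_idm; repeat rewrite ?tens1_unitl, ?tens1_unitr.

Ltac eval_dom_cod := let H := base_object in repeat match goal with
 | |- context [dom ?f] =>
     let h := fresh in eassert (h : homH H f _ _) by solve_homH;
     rewrite (dom_homH _ _ _ _ _ h); clear h
 | |- context [cod ?f] =>
     let h := fresh in eassert (h : homH H f _ _) by solve_homH;
     rewrite (cod_homH _ _ _ _ _ h); clear h
 end; cbn [Hpow Nat.add]; repeat rewrite <- tens_idm; repeat rewrite ?tens1_unitl, ?tens1_unitr.

Ltac factor_tens f g :=
  first [ rewrite (tens_factorl _ f g); eval_dom_cod; reflexivity
        | rewrite (tens_factorr _ f g); eval_dom_cod; reflexivity ].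

Ltac interchange f g := transitivity (f ⊗ g); [factor_tens f g | factor_tens f g].

Section Frobenius.
Variables (C : SSMC) (H : Ob C) (m u d c : Mor C).
Hypothesis F : is_frobenius C H m u d c.
Notation "'ι'" := (idm H).

Let m_hom : homH H m 2 1 := proj1 (proj1 F).
Let u_hom : homH H u 0 1 := proj1 (proj2 (proj1 F)).
Let d_hom : homH H d 1 2 := proj1 (proj1 (proj2 F)).
Let c_hom : homH H c 1 0 := proj1 (proj2 (proj1 (proj2 F))).

Lemma frobenius_snakel : (ι ⊗ (c ∘ m)) ∘ ((d ∘ u) ⊗ ι) = ι.
Proof.
  pose proof F as [[_ [_ [_ [m_unitl _]]]] [[_ [_ [_ [_ c_unitr]]]] [frob_l _]]].
  unfold id_H in *.
  rewrite tens_comp_idmr, tens_comp_idml by solve_composable. assoc_r.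
  rewrite_chain frob_l. rewrite_chain m_unitl. simpl_idm. exact c_unitr.
Qed.

Lemma frobenius_snaker : ((c ∘ m) ⊗ ι) ∘ (ι ⊗ (d ∘ u)) = ι.
Proof.
  pose proof F as [[_ [_ [_ [_ m_unitr]]]] [[_ [_ [_ [c_unitl _]]]] [_ frob_r]]].
  unfold id_H in *.
  rewrite tens_comp_idmr, tens_comp_idml by solve_composable. assoc_r.
  rewrite_chain (eq_sym frob_r). rewrite_chain m_unitr. simpl_idm. exact c_unitl.
Qed.

Lemma map_copairingP f k : homH H f 1 1 -> homH H k 0 2 ->
  f = (ι ⊗ (c ∘ m)) ∘ (k ⊗ ι) <-> (f ⊗ ι) ∘ (d ∘ u) = k.
Proof.
  intros f_hom k_hom; split; [intros -> | intros <-].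
  - rewrite tens_comp_idml by solve_composable. assoc_r. rewrite !tens1_assoc.
    assert (slide : (k ⊗ (ι ⊗ ι)) ∘ (d ∘ u) = ((ι ⊗ ι) ⊗ (d ∘ u)) ∘ k)
      by interchange k (d ∘ u).
    rewrite slide, tens1_assoc. merge_tens. rewrite frobenius_snaker. simpl_idm. reflexivity.
  - rewrite tens_comp_idml by solve_composable. assoc_r. rewrite tens1_assoc.
    merge_tens. simpl_idm. rewrite tens_factorl. eval_dom_cod.
    rewrite_chain frobenius_snakel. simpl_idm. reflexivity.
Qed.

Lemma copairing_unique k : homH H k 0 2 -> (ι ⊗ (c ∘ m)) ∘ (k ⊗ ι) = ι -> k = d ∘ u.
Proof.
  intros k_hom E. symmetry in E.
  apply map_copairingP in E; [| solve_homH | assumption].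
  rewrite <- E. simpl_idm. reflexivity.
Qed.

Lemma map_of_pairing f : homH H f 1 1 -> f = ((c ∘ m ∘ (f ⊗ ι)) ⊗ ι) ∘ (ι ⊗ (d ∘ u)).
Proof.
  intros f_hom.
  rewrite tens_comp_idml by solve_composable. assoc_r. rewrite tens1_assoc.
  assert (slide : (f ⊗ ι ⊗ ι) ∘ (ι ⊗ (d ∘ u)) = (ι ⊗ (d ∘ u)) ∘ f)
    by interchange f (d ∘ u).
  rewrite slide. rewrite_chain frobenius_snaker. simpl_idm. reflexivity.
Qed.

Lemma pairing_inj f g : homH H f 1 1 -> homH H g 1 1 ->
  c ∘ m ∘ (f ⊗ ι) = c ∘ m ∘ (g ⊗ ι) -> f = g.
Proof.
  intros f_hom g_hom E.
  now rewrite (map_of_pairing f), (map_of_pairing g), E.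
Qed.

End Frobenius.

Section Hopf.
Variables (C : SSMC) (H : Ob C) (mu eta Delta eps s : Mor C).
Hypothesis HA : is_hopf C H mu eta Delta eps s.
Notation "'ι'" := (idm H).

Let mu_hom : homH H mu 2 1 := proj1 (proj1 HA).
Let eta_hom : homH H eta 0 1 := proj1 (proj2 (proj1 HA)).
Let Delta_hom : homH H Delta 1 2 := proj1 (proj1 (proj2 HA)).
Let eps_hom : homH H eps 1 0 := proj1 (proj2 (proj1 (proj2 HA))).
Let s_hom : homH H s 1 1 := proj1 (proj2 (proj2 HA)).

Ltac hopf_laws :=
  pose proof HA as [[_ [_ [mu_assoc [mu_unitl mu_unitr]]]]
                   [[_ [_ [Delta_coassoc [eps_counitl eps_counitr]]]]
                   [_ [bialg [Delta_eta [eps_mu [eps_eta [antipode_l antipode_r]]]]]]]];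
  unfold id_H in *;
  repeat (rewrite <- comp_assoc in bialg, antipode_l, antipode_r by solve_composable).

Lemma hopf_counit_antipode : eps ∘ s = eps.
Proof.
  hopf_laws.
  transitivity (((eps ∘ s) ⊗ eps) ∘ Delta).
  - rewrite tens_factorl. eval_dom_cod. rewrite_chain eps_counitr. simpl_idm. reflexivity.
  - rewrite tens_compl by solve_composable. eval_dom_cod. rewrite <- eps_mu.
    rewrite_chain antipode_l. rewrite_chain eps_eta. simpl_idm. reflexivity.
Qed.

Lemma hopf_antipode_unit : s ∘ eta = eta.
Proof.
  hopf_laws.
  transitivity (mu ∘ ((ι ⊗ eta) ∘ (s ∘ eta))).
  - rewrite_chain mu_unitr. simpl_idm. reflexivity.
  - transitivity (mu ∘ ((s ⊗ ι) ∘ (Delta ∘ eta))).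
    + f_equal. rewrite Delta_eta. merge_tens. simpl_idm. factor_tens (s ∘ eta) eta.
    + rewrite_chain antipode_l. rewrite_chain eps_eta. simpl_idm. reflexivity.
Qed.

Lemma right_integral_antipode_pairing lambda p :
  is_right_integral C H eta Delta lambda -> homH H p 0 1 ->
  (ι ⊗ (lambda ∘ mu)) ∘ (((s ⊗ ι) ∘ (Delta ∘ p)) ⊗ ι)
  = (ι ⊗ (lambda ∘ (mu ∘ (p ⊗ ι)))) ∘ Delta.
Proof.
  (* In Sweedler notation: S(p1) λ(p2 x) = S(p1) p2 x1 λ(p3 x2) = x1 λ(p x2), expanding
     λ(y) 1 = y1 λ(y2) at y = p2 x and then cancelling S(p1) p2 = ε(p1). *)
  intros [lambda_hom right_int] p_hom. change (homH H lambda 1 0) in lambda_hom. hopf_laws.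
  set (rhs := (ι ⊗ (lambda ∘ (mu ∘ (p ⊗ ι)))) ∘ Delta).
  transitivity
    (mu ∘ ((ι ⊗ eta) ∘ ((ι ⊗ (lambda ∘ mu)) ∘ (((s ⊗ ι) ∘ (Delta ∘ p)) ⊗ ι)))).
  { rewrite_chain mu_unitr. simpl_idm. reflexivity. }
  merge_tens. simpl_idm. rewrite_chain (eq_sym right_int). rewrite_chain bialg.
  merge_tens. simpl_idm. rewrite !tens_comp_idmr by solve_composable. assoc_r.
  assert (mu_assoc4 :
    mu ∘ (ι ⊗ (mu ⊗ (lambda ∘ mu))) = mu ∘ (mu ⊗ (ι ⊗ (lambda ∘ mu)))).
  { rewrite (tens_factorl _ mu (lambda ∘ mu)). eval_dom_cod.
    rewrite tens_comp_idmr by solve_composable. rewrite_chain (eq_sym mu_assoc).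
    rewrite (tens1_assoc _ ι ι (lambda ∘ mu)), <- (tens1_assoc _ ι ι (ι ⊗ (lambda ∘ mu))).
    merge_tens. simpl_idm. reflexivity. }
  assert (coassoc_slide : (ι ⊗ (Delta ⊗ Delta)) ∘ (((s ⊗ ι) ∘ (Delta ∘ p)) ⊗ ι)
          = (s ⊗ (ι ⊗ (ι ⊗ (ι ⊗ ι)))) ∘ (((Delta ⊗ ι) ∘ (Delta ∘ p)) ⊗ Delta)).
  { rewrite tens_comp_idml by solve_composable. rewrite (tens1_assoc _ s ι ι).
    merge_tens. simpl_idm. rewrite (tens_factorl _ s (Delta ⊗ Delta)). eval_dom_cod. assoc_r.
    f_equal. rewrite tens_comp_idml by solve_composable. rewrite <- (tens1_assoc _ ι Delta Delta).
    merge_tens. rewrite <- Delta_coassoc. simpl_idm. merge_tens. simpl_idm. assoc_r. reflexivity. }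
  assert (antipode_block :
    (mu ⊗ (ι ⊗ (lambda ∘ mu)))
      ∘ ((ι ⊗ (ι ⊗ (sym H H ⊗ ι))) ∘ (s ⊗ (ι ⊗ (ι ⊗ (ι ⊗ ι)))))
    = (mu ∘ (s ⊗ ι)) ⊗ ((ι ⊗ (lambda ∘ mu)) ∘ (sym H H ⊗ ι))).
  { rewrite <- (tens1_assoc _ ι ι (sym H H ⊗ ι)). merge_tens. simpl_idm.
    rewrite <- (tens1_assoc _ s ι (ι ⊗ (ι ⊗ ι))). merge_tens. simpl_idm. reflexivity. }
  rewrite_chain mu_assoc4. rewrite coassoc_slide. rewrite_chain antipode_block.
  rewrite (tens_compl _ (Delta ⊗ ι)) by solve_composable. eval_dom_cod. rewrite tens1_assoc.
  merge_tens. rewrite_chain antipode_l.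
  rewrite tens_compl by solve_composable. eval_dom_cod. assoc_r.
  rewrite <- (tens1_assoc _ eps ι ι). merge_tens. rewrite_chain eps_counitl. simpl_idm.
  rewrite (tens_factorl _ eta). eval_dom_cod. rewrite_chain mu_unitl. simpl_idm.
  assert (slide : (ι ⊗ Delta) ∘ (p ⊗ ι) = (p ⊗ (ι ⊗ ι)) ∘ Delta) by interchange p Delta.
  rewrite slide. rewrite <- (tens1_assoc _ p ι ι). merge_tens. simpl_idm.
  rewrite (sym_point _ p H H p_hom). simpl_idm.
  subst rhs. rewrite tens1_assoc. merge_tens. simpl_idm. assoc_r. reflexivity.
Qed.

Lemma integral_pairing_copairing Lambda lambda :
  is_left_cointegral C H mu eps Lambda -> is_right_integral C H eta Delta lambda ->
  lambda ∘ Lambda = idm unitOb ->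
  (ι ⊗ (lambda ∘ mu)) ∘ (((s ⊗ ι) ∘ (Delta ∘ Lambda)) ⊗ ι) = ι.
Proof.
  intros [Lambda_hom left_coint] lambda_int normalized.
  pose proof lambda_int as [lambda_hom _].
  change (homH H Lambda 0 1) in Lambda_hom. change (homH H lambda 1 0) in lambda_hom.
  unfold id_H in left_coint. rewrite right_integral_antipode_pairing by assumption.
  hopf_laws. rewrite left_coint. rewrite_chain normalized. simpl_idm. exact eps_counitr.
Qed.

End Hopf.

Section PreHopfFrobenius.
Variables (C : SSMC) (H : Ob C) (m u d c M U D e s : Mor C).
Hypothesis P : is_pre_hopf_frobenius C H m u d c M U D e s.
Notation "'ι'" := (idm H).

Let green : is_frobenius C H m u d c := proj1 P.
Let red : is_frobenius C H M U D e := proj1 (proj2 P).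
Let hopf : is_hopf C H m u D e s := proj2 (proj2 P).

Let m_hom : homH H m 2 1 := proj1 (proj1 green).
Let u_hom : homH H u 0 1 := proj1 (proj2 (proj1 green)).
Let d_hom : homH H d 1 2 := proj1 (proj1 (proj2 green)).
Let c_hom : homH H c 1 0 := proj1 (proj2 (proj1 (proj2 green))).
Let M_hom : homH H M 2 1 := proj1 (proj1 red).
Let U_hom : homH H U 0 1 := proj1 (proj2 (proj1 red)).
Let D_hom : homH H D 1 2 := proj1 (proj1 (proj2 red)).
Let e_hom : homH H e 1 0 := proj1 (proj2 (proj1 (proj2 red))).
Let s_hom : homH H s 1 1 := proj1 (proj2 (proj2 hopf)).

Lemma antipode_formulaP :
  s = (ι ⊗ (e ∘ M)) ∘ ((d ∘ u) ⊗ ι) <-> (s ⊗ ι) ∘ (D ∘ U) = d ∘ u.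
Proof. apply map_copairingP; [exact red | exact s_hom | solve_homH]. Qed.

Section FromCopairing.
Hypothesis copairing : (s ⊗ ι) ∘ (D ∘ U) = d ∘ u.

Lemma red_unit_green_copairing : (e ⊗ ι) ∘ (d ∘ u) = U.
Proof.
  pose proof hopf as [_ [[_ [_ [_ [e_counitl _]]]] _]]. unfold id_H in e_counitl.
  rewrite <- copairing. merge_tens. rewrite (hopf_counit_antipode _ _ _ _ _ _ _ hopf).
  simpl_idm. rewrite_chain e_counitl. simpl_idm. reflexivity.
Qed.

Lemma green_pairing_red_unit : c ∘ (m ∘ (U ⊗ ι)) = e.
Proof.
  transitivity (e ∘ ((ι ⊗ (c ∘ m)) ∘ ((d ∘ u) ⊗ ι))).
  2: { rewrite (frobenius_snakel _ _ _ _ _ _ green). simpl_idm. reflexivity. }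
  assert (swap : e ∘ (ι ⊗ (c ∘ m)) = (c ∘ m) ∘ ((e ⊗ ι) ⊗ ι)).
  { transitivity (e ⊗ (c ∘ m)).
    - factor_tens e (c ∘ m).
    - rewrite (tens_factorr _ e (c ∘ m)). eval_dom_cod. rewrite tens1_assoc. reflexivity. }
  rewrite_chain swap. merge_tens. rewrite red_unit_green_copairing. simpl_idm. reflexivity.
Qed.

Lemma green_counit_red_unit : c ∘ U = idm unitOb.
Proof.
  pose proof hopf as [[_ [_ [_ [_ m_unitr]]]] [_ [_ [_ [_ [_ [e_u _]]]]]]]. unfold id_H in m_unitr.
  transitivity (c ∘ (m ∘ ((ι ⊗ u) ∘ U))).
  { rewrite_chain m_unitr. simpl_idm. reflexivity. }
  assert (slide : (ι ⊗ u) ∘ U = (U ⊗ ι) ∘ u) by interchange U u.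
  rewrite slide. rewrite_chain green_pairing_red_unit. exact e_u.
Qed.

Lemma red_unit_left_cointegral : m ∘ (U ⊗ ι) = U ∘ e.
Proof.
  pose proof hopf as [[_ [_ [m_assoc _]]] [_ [_ [_ [_ [e_m _]]]]]]. unfold id_H in m_assoc.
  apply (pairing_inj _ _ _ _ _ _ green); [solve_homH .. |].
  rewrite (tens_comp_idml _ m), (tens_comp_idml _ U) by solve_composable. assoc_r.
  rewrite_chain m_assoc.
  assert (slide : (ι ⊗ m) ∘ ((U ⊗ ι) ⊗ ι) = (U ⊗ ι) ∘ m).
  { rewrite tens1_assoc. interchange U m. }
  rewrite slide. rewrite_chain green_pairing_red_unit. rewrite_chain green_pairing_red_unit.
  rewrite e_m. factor_tens e e.
Qed.

Lemma green_pairing_antipode : c ∘ (m ∘ (ι ⊗ s)) = e ∘ M.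
Proof.
  rewrite (proj2 antipode_formulaP copairing) at 1. rewrite tens_comp_idmr by solve_composable.
  assert (swap : c ∘ (m ∘ (ι ⊗ (ι ⊗ (e ∘ M)))) = (e ∘ M) ∘ ((c ∘ m) ⊗ (ι ⊗ ι))).
  { transitivity ((c ∘ m) ⊗ (e ∘ M)).
    - rewrite (tens_factorl _ (c ∘ m) (e ∘ M)). eval_dom_cod.
      rewrite tens1_assoc. assoc_r. reflexivity.
    - factor_tens (c ∘ m) (e ∘ M). }
  rewrite_chain swap.
  rewrite <- (tens1_assoc _ (c ∘ m) ι ι), <- (tens1_assoc _ ι (d ∘ u) ι).
  merge_tens. rewrite (frobenius_snaker _ _ _ _ _ _ green). simpl_idm. reflexivity.
Qed.

Lemma green_counit_red_pairing : c = e ∘ (M ∘ (ι ⊗ u)).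
Proof.
  pose proof hopf as [[_ [_ [_ [_ m_unitr]]]] _]. unfold id_H in m_unitr.
  transitivity (c ∘ (m ∘ (ι ⊗ u))). { rewrite m_unitr. simpl_idm. reflexivity. }
  rewrite <- (hopf_antipode_unit _ _ _ _ _ _ _ hopf) at 1.
  rewrite tens_comp_idmr by solve_composable. rewrite_chain green_pairing_antipode. reflexivity.
Qed.

Lemma green_counit_right_integral : (ι ⊗ c) ∘ D = u ∘ c.
Proof.
  pose proof red as [_ [[_ [_ [_ [e_counitl e_counitr]]]] [frob_l frob_r]]].
  pose proof hopf as [_ [_ [_ [_ [D_u _]]]]]. unfold id_H in *.
  transitivity (M ∘ (ι ⊗ u)).
  - rewrite green_counit_red_pairing at 1. rewrite !tens_comp_idmr by solve_composable. assoc_r.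
    assert (slide : (ι ⊗ (ι ⊗ u)) ∘ D = (D ⊗ ι) ∘ (ι ⊗ u)).
    { transitivity (D ⊗ u).
      - rewrite (tens_factorr _ D u). eval_dom_cod. rewrite tens1_assoc. reflexivity.
      - factor_tens D u. }
    rewrite slide. rewrite_chain frob_l. rewrite_chain e_counitr. simpl_idm. reflexivity.
  - transitivity ((e ⊗ ι) ∘ (D ∘ (M ∘ (ι ⊗ u)))).
    { rewrite_chain e_counitl. simpl_idm. reflexivity. }
    rewrite_chain frob_r. merge_tens. merge_tens.
    rewrite D_u. simpl_idm. rewrite <- (tens1_assoc _ ι u u). merge_tens. assoc_r.
    rewrite <- green_counit_red_pairing. simpl_idm. factor_tens c u.
Qed.

Lemma integral_hopf_of_copairing : is_integral_hopf C H m u D e s U c.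
Proof.
  split; [exact hopf |]. split; [split; [exact U_hom | exact red_unit_left_cointegral] |].
  split; [split; [exact c_hom | exact green_counit_right_integral] |].
  exact green_counit_red_unit.
Qed.

End FromCopairing.

Lemma copairing_of_integral_hopf :
  is_integral_hopf C H m u D e s U c -> (s ⊗ ι) ∘ (D ∘ U) = d ∘ u.
Proof.
  intros [_ [left_coint [right_int normalized]]].
  apply (copairing_unique _ _ _ _ _ _ green); [solve_homH |].
  exact (integral_pairing_copairing _ _ _ _ _ _ _ hopf _ _ left_coint right_int normalized).
Qed.
End PreHopfFrobenius.

Theorem mainTheorem4 (C : SSMC) (H : Ob C)
    (mug etag deltag epsg mur etar deltar epsr s : Mor C) :
  is_pre_hopf_frobenius C H mug etag deltag epsg mur etar deltar epsr s ->
  (is_integral_hopf C H mug etag deltar epsr s etar epsg <->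
   s = (idm H ⊗ (epsr ∘ mur)) ∘ ((deltag ∘ etag) ⊗ idm H)).
Proof.
  intros P. rewrite (antipode_formulaP _ _ _ _ _ _ _ _ _ _ _ P).
  split.
  - exact (copairing_of_integral_hopf _ _ _ _ _ _ _ _ _ _ _ P).
  - exact (integral_hopf_of_copairing _ _ _ _ _ _ _ _ _ _ _ P).
Qed.
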